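(* Let $\mathscr{B}=\mathscr{B}_-\oplus\mathscr{B}_0\oplus\mathscr{B}_+$ be a decomposition of a Banach space into a direct sum of closed subspaces, and let $T_L$, $T_R$ be closed linear operators on $\mathscr{B}_L=\mathscr{B}_-\oplus\mathscr{B}_0$ and $\mathscr{B}_R=\mathscr{B}_0\oplus\mathscr{B}_+$ respectively. Denote by $0_k$ and $1_k$ the null and identity operators on $\mathscr{B}_k$ for any subindex $k$, and let $P$ = projection of $\mathscr{B}$ onto $\mathscr{B}_0$ along $\mathscr{B}_-\oplus\mathscr{B}_+$, $Q=1-P$; $P_L$ = projection of $\mathscr{B}_L$ onto $\mathscr{B}_0$ along $\mathscr{B}_-$, $Q_L=1_L-P_L$; $P_R$ = projection of $\mathscr{B}_R$ onto $\mathscr{B}_0$ along $\mathscr{B}_+$, $Q_R=1_R-P_R$. Suppose $\mathscr{B}_0\subset\mathscr{D}(T_L)$ and $\mathscr{B}_0\subset\mathscr{D}(T_R)$, and let $f_L$, $f_R$ be the FR-functions of $P_L$, $P_R$ with respect to $T_L$, $T_R$ respectively. Then: (i) (Decomposition) $T=(T_L\oplus0_+)+(0_-\oplus T_R)$ has domain $\mathscr{D}(T)=\mathscr{D}(T_L)+\mathscr{D}(T_R)$ and the FR-function $f$ of $P$ with respect to $T$ is given by $$f(z)=f_L(z)+f_R(z),\qquad z^{-1}\in\varpi(Q_LT_LQ_L)\cap\varpi(Q_RT_RQ_R).$$ (ii) (Factorization) $T=(T_L\oplus1_+)(1_-\oplus T_R)$ has domain $\mathscr{D}(T)=\mathscr{D}(T_L)+\mathscr{D}(T_R)$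 and the FR-function $f$ of $P$ with respect to $T$ is given by $$f(z)=f_L(z)f_R(z),\qquad z^{-1}\in\varpi(Q_LT_LQ_L)\cap\varpi(Q_RT_RQ_R).$$
   Context: Operators need not be bounded or everywhere defined; sums and products have their natural domains. For a linear operator $S\colon\mathscr{D}(S)\to X$ on a Banach space $X$, $\varpi(S)=\{\lambda\in\mathbb{C}:\ker(\lambda-S)=\{0\},\ \mathrm{Range}(\lambda-S)=X\}$. Given a bounded projection $P$ of a Banach space onto a closed subspace $\mathscr{B}_0$ and a linear operator $T$, with $Q=1-P$, the FR-function (first return function) of $P$ with respect to $T$ is $f(z)=PT(1-zQT)^{-1}P$, regarded as an operator on $\mathscr{B}_0$, for $z\ne0$ with $z^{-1}\in\varpi(QT)$. The same definition is used for $T_L,P_L$ on $\mathscr{B}_L$ and $T_R,P_R$ on $\mathscr{B}_R$. The operator $Q_LT_LQ_L$ is regarded as an operator on $\mathscr{B}_-$ with domain $\mathscr{B}_-\cap\mathscr{D}(T_L)$, and $Q_RT_RQ_R$ as an operator on $\mathscr{B}_+$ with domain $\mathscr{B}_+\cap\mathscr{D}(T_R)$. *)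

(* Defs.v *)
From HB Require Import structures.
From mathcomp Require Import all_boot all_order all_algebra.
From mathcomp Require Import complex.
From mathcomp Require Import all_classical all_reals all_analysis.
Set Implicit Arguments.
Unset Strict Implicit.
Unset Printing Implicit Defensive.
Import Order.TTheory GRing.Theory Num.Theory.
Import numFieldNormedType.Exports.
Local Open Scope classical_set_scope.
Local Open Scope ring_scope.

(* A partially defined operator is represented by its graph, a set of pairs
   in V * V.  All algebraic operations then carry their natural domains, and
   equality of operators (same domain, same values) is equality of graphs.
   Subspaces of V are plain sets, and an operator "on the subspace X" is one
   whose graph is contained in X `*` X. *)
Section Operators.
Variables (K : numFieldType) (V : normedModType K).
Implicit Types (A B C N X : set V) (S T P : set (V * V)) (z l : K).

Definition closed_subspace A := GRing.submod_closed (mem A) /\ closed A.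

Definition sumset A B : set V := [set x + y | x in A & y in B].

(* For closed subspaces of a Banach space the projections attached to such a
   decomposition are bounded, by the open mapping theorem. *)
Definition direct_sum3 A B C :=
  forall x, exists! t : V * V * V,
    [/\ A t.1.1, B t.1.2, C t.2 & x = t.1.1 + t.1.2 + t.2].

Definition is_linop X T :=
  [/\ T `<=` X `*` X,
      GRing.submod_closed (mem T)
    & forall x y y', T (x, y) -> T (x, y') -> y = y'].

(* The graph is relatively closed in X `*` X. *)
Definition is_closed_op X T := closure T `&` (X `*` X) `<=` T.

Definition op_dom T : set V := [set x | exists y, T (x, y)].
Definition op_ran T : set V := [set y | exists x, T (x, y)].
Definition op_ker T : set V := [set x | T (x, 0)].

Definition op_id X : set (V * V) := [set p | X p.1 /\ p.2 = p.1].
Definition op_zero X : set (V * V) := [set p | X p.1 /\ p.2 = 0].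

Definition op_add S T : set (V * V) :=
  [set p | exists y y', [/\ S (p.1, y), T (p.1, y') & p.2 = y + y']].
Definition op_scale z T : set (V * V) :=
  [set p | exists2 y, T (p.1, y) & p.2 = z *: y].
Definition op_sub S T := op_add S (op_scale (-1) T).
Definition op_comp S T : set (V * V) :=
  [set p | exists2 y, T (p.1, y) & S (y, p.2)].
Definition op_inv T : set (V * V) := [set p | T (p.2, p.1)].

(* S (+) T on X (+) Y, for S on X, T on Y and X, Y in direct sum:
   x + y |-> S x + T y. *)
Definition op_dsum S T : set (V * V) :=
  [set p | exists x y x' y',
     [/\ S (x, x'), T (y, y'), p.1 = x + y & p.2 = x' + y']].

(* T regarded as an operator on the subspace A. *)
Definition op_on A T : set (V * V) := T `&` (A `*` A).

(* Projection of sumset A N onto A along N (for A, N in direct sum). *)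
Definition op_proj A N : set (V * V) :=
  [set p | A p.2 /\ exists2 n, N n & p.1 = p.2 + n].

(* The set \varpi(S), for S an operator on X. *)
Definition varpi X S : set K :=
  [set l | let U := op_sub (op_scale l (op_id X)) S in
           op_ker U = [set 0] /\ op_ran U = X].

(* For a projection P of X onto A and an operator T on X, the FR-function
   sends z in FRdom X P T to the operator FR X A P T z on A. *)
Definition FRdom X P T : set K :=
  [set z | z != 0 /\ varpi X (op_comp (op_sub (op_id X) P) T) z^-1].

Definition FR X A P T z : set (V * V) :=
  let Q := op_sub (op_id X) P in
  let resolvent := op_inv (op_sub (op_id X) (op_scale z (op_comp Q T))) in
  op_on A (op_comp P (op_comp T (op_comp resolvent P))).

End Operators.

Declare Scope operator_scope.
Delimit Scope operator_scope with op.
Notation "S + T" := (op_add S T) : operator_scope.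
Notation "S - T" := (op_sub S T) : operator_scope.
Notation "S * T" := (op_comp S T) : operator_scope.
Notation "S (+) T" := (op_dsum S T) : operator_scope.

(* Sums, products and direct sums of linear operators are linear operators. *)
Section Sanity.
Variables (K : numFieldType) (V : normedModType K).
Implicit Types (A B X Y : set V) (S T : set (V * V)).

Lemma submodP (W : lmodType K) (A : set W) :
  GRing.submod_closed (mem A) <->
  A 0 /\ forall a u v, A u -> A v -> A (a *: u + v).
Proof.
split=> -[A0 Al]; split.
- by move: A0 => /set_mem.
- by move=> a u v Au Av; apply/set_mem/Al; apply/mem_set.
- exact/mem_set.
- by move=> a u v /set_mem Au /set_mem Av; apply/mem_set/Al.
Qed.

Lemma is_linop_add X S T :
  GRing.submod_closed (mem X) ->
  is_linop X S -> is_linop X T -> is_linop X (S + T)%op.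
Proof.
move=> /submodP[_ Xl] [SX /submodP[S0 Sl] Sf] [TX /submodP[T0 Tl] Tf]; split.
- move=> [x y] [u] [v] /= [/SX[/= ? ?] /TX[/= ? ?] ->].
  by split=> //=; rewrite -[u]scale1r; exact: Xl.
- apply/submodP; split; first by exists 0, 0; rewrite addr0.
  move=> a [x1 y1] [x2 y2] [u1] [v1] /= [Su1 Tv1 ->] [u2] [v2] /= [Su2 Tv2 ->].
  exists (a *: u1 + u2), (a *: v1 + v2); split.
  + exact: (Sl a _ _ Su1 Su2).
  + exact: (Tl a _ _ Tv1 Tv2).
  + by rewrite /= scalerDr addrACA.
- move=> x y y' [u] [v] /= [Su Tv ->] [u'] [v'] /= [Su' Tv' ->].
  by rewrite (Sf _ _ _ Su Su') (Tf _ _ _ Tv Tv').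
Qed.

Lemma is_linop_comp X S T :
  is_linop X S -> is_linop X T -> is_linop X (S * T)%op.
Proof.
move=> [SX /submodP[S0 Sl] Sf] [TX /submodP[T0 Tl] Tf]; split.
- by move=> [x y] [u] /= /TX[/= ? ?] /SX[/= ? ?].
- apply/submodP; split; first by exists 0.
  move=> a [x1 y1] [x2 y2] [u1] /= Tu1 Su1 [u2] /= Tu2 Su2.
  exists (a *: u1 + u2); first exact: (Tl a _ _ Tu1 Tu2).
  exact: (Sl a _ _ Su1 Su2).
- move=> x y y' [u] /= Tu Su [u'] /= Tu' Su'.
  by rewrite -(Tf _ _ _ Tu Tu') in Su'; exact: Sf Su Su'.
Qed.

Lemma is_linop_dsum X Y S T :
  GRing.submod_closed (mem X) -> GRing.submod_closed (mem Y) ->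
  X `&` Y = [set 0] ->
  is_linop X S -> is_linop Y T -> is_linop (sumset X Y) (S (+) T)%op.
Proof.
move=> /submodP[X0 Xl] /submodP[Y0 Yl] XY.
move=> [SX /submodP[S0 Sl] Sf] [TY /submodP[T0 Tl] Tf]; split.
- move=> [x y] [u] [v] [u'] [v'] /= [/SX[/= ? ?] /TY[/= ? ?] -> ->].
  by split; [exists u => //; exists v | exists u' => //; exists v'].
- apply/submodP; split; first by exists 0, 0, 0, 0; rewrite addr0.
  move=> a [x1 y1] [x2 y2] [u1] [v1] [s1] [t1] /= [Ss1 Tt1 -> ->].
  move=> [u2] [v2] [s2] [t2] /= [Ss2 Tt2 -> ->].
  exists (a *: u1 + u2), (a *: v1 + v2), (a *: s1 + s2), (a *: t1 + t2); split.
  + exact: (Sl a _ _ Ss1 Ss2).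
  + exact: (Tl a _ _ Tt1 Tt2).
  + by rewrite /= scalerDr addrACA.
  + by rewrite /= scalerDr addrACA.
- move=> x y y' [u] [v] [s] [t] /= [Ss Tt -> ->].
  move=> [u'] [v'] [s'] [t'] /= [Ss' Tt' E ->].
  have [Xu _] := SX _ Ss; have [Xu' _] := SX _ Ss'.
  have [Yv _] := TY _ Tt; have [Yv' _] := TY _ Tt'.
  rewrite /= in Xu Xu' Yv Yv'.
  have D : u - u' = v' - v.
    by apply/eqP; rewrite subr_eq addrAC eq_sym subr_eq addrC -E addrC.
  have : (X `&` Y) (u - u').
    split; first by rewrite addrC -scaleN1r; exact: Xl.
    by rewrite D addrC -scaleN1r; exact: Yl.
  rewrite XY => /= e0.
  have eu : u = u' by apply/eqP; rewrite -subr_eq0 e0.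
  have ev : v = v' by apply/eqP; rewrite eq_sym -subr_eq0 -D e0.
  by subst u' v'; rewrite (Sf _ _ _ Ss Ss') (Tf _ _ _ Tt Tt').
Qed.

End Sanity.

(* Main.v *)
Require Import Defs.
From HB Require Import structures.
From mathcomp Require Import all_boot all_order all_algebra.
From mathcomp Require Import complex.
From mathcomp Require Import all_classical all_reals all_analysis.
Import Order.TTheory GRing.Theory Num.Theory.
Import numFieldNormedType.Exports.
Local Open Scope classical_set_scope.
Local Open Scope ring_scope.

(** The argument is purely algebraic; it consists in removing the resolvent
from the first return function.  If [x] solves [(1 - z Q T) x = w] with [w] in
the range [A] of the projection, then the component of [x] in [A] is [w], and
the component [n] in the complement [N] satisfies [n = z Q T (w + n)].  So
[f(z) w = v] holds exactly when, for some [n] in [N],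

      [T (w + n) = v + z^-1 n].

This is [FR_graph].  By the same computation, with [l = z^-1], bijectivity of
[l - Q T] reduces to bijectivity of its compression to [N]: for every [m] in
[N], the equation [Q T n = l n - m] must have exactly one solution [n] in [N].
This is [compression_regular], reached from the spectral condition by
[varpi_compression_regular] and sufficient by [compression_regular_FRdom].
That last step needs [A] to be contained in the domain of [T], so that the
part of an equation living in [A] can be moved to its right-hand side.

For [a + b + c] in [Bm + B0 + Bp], both operators built from [TL] and [TR] can
be written out by components.  For the sum, apply [TL] to [a + b], apply [TR]
to [b + c], and add ([glued_sumE]).  For the product, apply [TR] to [b + c],
obtaining [e + c'], and then apply [TL] to [a + e], the component [c'] being
carried along ([glued_prodE]).  Comparing components, the equation

      [T (w + a + c) = v + l (a + c)]

becomes, for the sum, [TL (w + a) = v1 + l a] and [TR (w + c) = v2 + l c] with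
[v = v1 + v2], that is [v1 = fL w] and [v2 = fR w].  For the product it
becomes [TR (w + c) = e + l c] and [TL (e + a) = v + l a], that is [e = fR w]
and [v = fL e].  The same splitting shows that the compression of [T] to
[Bm + Bp] is block diagonal for the sum and block triangular for the product,
with the compressions of [TL] and [TR] on the diagonal, so regularity of these
two gives regularity of [T] ([glued_sum_regular], [glued_prod_regular]). *)

(** * Subspaces and linear graphs *)

Section Subspaces.
Set Implicit Arguments.
Unset Strict Implicit.
Context {K : numFieldType} {V : normedModType K}.
Implicit Types (A N X Y : set V) (S T : set (V * V)).

Lemma submod_add (W : lmodType K) (A : set W) u v :
  GRing.submod_closed (mem A) -> A u -> A v -> A (u + v).
Proof. by move=> /submodP[_ Al] Au Av; rewrite -[u]scale1r; exact: Al. Qed.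

Lemma submod_scale (W : lmodType K) (A : set W) k u :
  GRing.submod_closed (mem A) -> A u -> A (k *: u).
Proof. by move=> /submodP[A0 Al] Au; rewrite -[_ *: _]addr0; exact: Al. Qed.

Lemma submod_sub (W : lmodType K) (A : set W) u v :
  GRing.submod_closed (mem A) -> A u -> A v -> A (u - v).
Proof.
by move=> Asub Au Av; rewrite -scaleN1r; apply: submod_add => //; exact: submod_scale.
Qed.

Lemma sumsetC A N : sumset A N = sumset N A.
Proof.
by apply/seteqP; split=> _ [a ? [n ? <-]]; exists n => //; exists a => //; rewrite addrC.
Qed.

Lemma submod_sumset A N :
  GRing.submod_closed (mem A) -> GRing.submod_closed (mem N) ->
  GRing.submod_closed (mem (sumset A N)).
Proof.
move=> /submodP[A0 Al] /submodP[N0 Nl]; apply/submodP; split.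
  by exists 0 => //; exists 0 => //; rewrite addr0.
move=> k _ _ [a Aa [n Nn <-]] [a' Aa' [n' Nn' <-]].
exists (k *: a + a'); first exact: Al.
by exists (k *: n + n'); [exact: Nl | rewrite scalerDr addrACA].
Qed.

Lemma sum_inj A N a n a' n' :
  GRing.submod_closed (mem A) -> GRing.submod_closed (mem N) ->
  A `&` N = [set 0] -> A a -> N n -> A a' -> N n' ->
  a + n = a' + n' -> a = a' /\ n = n'.
Proof.
move=> Asub Nsub AN Aa Nn Aa' Nn' E.
have D : a - a' = n' - n.
  by apply/eqP; rewrite subr_eq addrAC eq_sym subr_eq addrC -E addrC.
have : (A `&` N) (a - a').
  by split; [exact: submod_sub | rewrite D; exact: submod_sub].
rewrite AN => /= e0; split; apply/eqP; first by rewrite -subr_eq0 e0.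
by rewrite eq_sym -subr_eq0 -D e0.
Qed.

Lemma graph_add X T x y x' y' :
  is_linop X T -> T (x, y) -> T (x', y') -> T (x + x', y + y').
Proof. by case=> _ Tsub _ Txy Txy'; exact: (submod_add Tsub Txy Txy'). Qed.

Lemma dom_add X T x x' :
  is_linop X T -> op_dom T x -> op_dom T x' -> op_dom T (x + x').
Proof. by move=> Tlin [y Ty] [y' Ty']; exists (y + y'); exact: graph_add Tlin Ty Ty'. Qed.

Lemma dom_sub X T x x' :
  is_linop X T -> op_dom T x -> op_dom T x' -> op_dom T (x - x').
Proof.
by case=> _ Tsub _ [y Ty] [y' Ty']; exists (y - y'); exact: (submod_sub Tsub Ty Ty').
Qed.

Lemma op_dsumE X Y S T x y p :
  GRing.submod_closed (mem X) -> GRing.submod_closed (mem Y) ->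
  X `&` Y = [set 0] -> S `<=` X `*` X -> T `<=` Y `*` Y -> X x -> Y y ->
  op_dsum S T (x + y, p) <->
  exists s t, [/\ S (x, s), T (y, t) & p = s + t].
Proof.
move=> Xsub Ysub XY SX TY Xx Yy; split.
  move=> [x1] [y1] [s] [t] /= [Sx1 Ty1 E ->].
  have [/= Xx1 _] := SX _ Sx1; have [/= Yy1 _] := TY _ Ty1.
  have [-> ->] := sum_inj Xsub Ysub XY Xx Yy Xx1 Yy1 E.
  by exists s, t.
by move=> [s] [t] [Sx Ty ->]; exists x, y, s, t.
Qed.

Lemma op_zero_linop X : GRing.submod_closed (mem X) -> is_linop X (op_zero X).
Proof.
move=> /submodP[X0 Xl]; split.
- by case=> x y [Xx y0]; split=> //=; have -> : y = 0 by [].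
- apply/submodP; split=> // k u v [Xu u0] [Xv v0].
  by split=> /=; [exact: Xl | rewrite u0 v0 scaler0 addr0].
- by move=> x y y' [_ y0] [_ y'0]; exact: etrans y0 (esym y'0).
Qed.

Lemma op_id_linop X : GRing.submod_closed (mem X) -> is_linop X (op_id X).
Proof.
move=> /submodP[X0 Xl]; split.
- by case=> x y [Xx yx]; split=> //=; have -> : y = x by [].
- apply/submodP; split=> // k u v [Xu uE] [Xv vE].
  by split=> /=; [exact: Xl | rewrite uE vE].
- by move=> x y y' [_ yx] [_ y'x]; exact: etrans yx (esym y'x).
Qed.

Lemma op_subP S T x y :
  op_sub S T (x, y) <-> exists s t, [/\ S (x, s), T (x, t) & y = s - t].
Proof.
split.
  move=> [s [_ [Sx [t /= Tx ->] /= ->]]].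
  by exists s, t; rewrite scaleN1r.
move=> [s [t [Sx Tx ->]]]; exists s, (- t); split=> //=.
by exists t => //; rewrite scaleN1r.
Qed.

Lemma op_scale_id_subP l X S x u :
  op_sub (op_scale l (op_id X)) S (x, u) <->
  X x /\ exists2 s, S (x, s) & u = l *: x - s.
Proof.
rewrite op_subP; split.
  by move=> [_ [s [[_ [/= Xx /= ->] /= ->] Sx ->]]]; split=> //; exists s.
by move=> [Xx [s Sx ->]]; exists (l *: x), s; split=> //; exists x.
Qed.

End Subspaces.

(** * Graph of a first return function *)

Section FirstReturn.
Set Implicit Arguments.
Unset Strict Implicit.
Context {K : numFieldType} {V : normedModType K}.
Variables (A N : set V) (T : set (V * V)).
Hypotheses (Asub : GRing.submod_closed (mem A)).
Hypotheses (Nsub : GRing.submod_closed (mem N)).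
Hypothesis AN : A `&` N = [set 0].
Hypothesis Tlin : is_linop (sumset A N) T.
Local Notation X := (sumset A N).
Local Notation P := (op_proj A N).

Lemma op_proj_compl : op_sub (op_id X) P = op_proj N A.
Proof.
apply/seteqP; split=> [[x y] | [x y] [/= Ny [a Aa ->]]].
  move=> /op_subP[s] [a] [[/= _ ->] [/= Aa [n Nn ->]] ->].
  by split=> /=; [rewrite addrAC subrr add0r | exists a => //; rewrite subrK].
apply/op_subP; exists (y + a), a; split.
- by split=> //=; exists a => //; exists y => //; rewrite addrC.
- by split=> //=; exists y => //; rewrite addrC.
- by rewrite addrK.
Qed.

(** The resolvent leaves the [A]-component of [w] alone, and its
[N]-component [n] is fixed by [z^-1 n = Q T (w + n)]. *)
Lemma FR_graph z : z != 0 ->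
  FR X A P T z = [set p | [/\ A p.1, A p.2 &
    exists2 n, N n & T (p.1 + n, p.2 + z^-1 *: n)]].
Proof.
move=> z0; have [TX _ Tfun] := Tlin.
have /submodP[A0 _] := Asub; have /submodP[N0 _] := Nsub.
rewrite /FR /= op_proj_compl; apply/seteqP; split=> [[w v]|[w v]].
  move=> [[y [x [u [/= Au [m Nm wE]] res] Txy] [/= Av [n Nn yE]]] [/= Aw _]].
  have [uw _] : w = u /\ 0 = m.
    by apply: (sum_inj Asub Nsub AN) => //; rewrite addr0.
  subst u; move: res => /op_subP[_] [_] [[/= _ ->] [k [y' /= Txy' Qy'] ->] wE'].
  have yy' := Tfun _ _ _ Txy Txy'; subst y'.
  case: Qy' => /= Nk [a Aa yE'].
  have [va nk] : v = a /\ n = k.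
    by apply: (sum_inj Asub Nsub AN) => //; rewrite -yE yE' addrC.
  (* [n] is here the [N]-component of [T x], and [z *: n] that of [x]. *)
  split=> //=; exists (z *: n); first exact: submod_scale.
  rewrite scalerA mulVf// scale1r -yE nk.
  by rewrite [X in X + _]wE' subrK.
move=> [/= Aw Av [n Nn Tn]].
have Nln : N (z^-1 *: n) by exact: submod_scale.
split=> //; exists (v + z^-1 *: n); last by split=> //=; exists (z^-1 *: n).
exists (w + n) => //; exists w; first by split=> //=; exists 0 => //; rewrite addr0.
apply/op_subP; exists (w + n), n; split; last by rewrite addrK.
  by split=> //=; have [] := TX _ Tn.
exists (z^-1 *: n); last by rewrite scalerA mulfV// scale1r.
exists (v + z^-1 *: n) => //; split=> //=.
by exists v => //; rewrite addrC.
Qed.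

(** Bijectivity on [N] of [l - Q T Q].  The projection onto [N] is expressed
by an arbitrary remainder [a] in [A], so that the condition speaks of [T]
alone. *)
Definition compression_regular l :=
  (forall a n, A a -> N n -> T (n, a + l *: n) -> n = 0) /\
  (forall m, N m -> exists a n, [/\ A a, N n & T (n, a + (l *: n - m))]).

Lemma op_compressionP n m :
  op_on N (op_comp (op_comp (op_proj N A) T) (op_proj N A)) (n, m) <->
  [/\ N n, N m & exists2 a, A a & T (n, a + m)].
Proof.
have /submodP[A0 _] := Asub.
split.
  move=> [[n1 [/= Nn1 [a Aa nE]] [y /= Ty [/= Nm [b Ab yE]]]] [/= Nn _]].
  have [_ nn1] : 0 = a /\ n = n1.
    by apply: (sum_inj Asub Nsub AN) => //; rewrite add0r nE addrC.
  by split=> //; exists b => //; rewrite nn1 addrC -yE.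
move=> [Nn Nm [a Aa Tn]]; split=> //.
exists n; first by split=> //=; exists 0 => //; rewrite addr0.
by exists (a + m) => //; split=> //=; exists a => //; rewrite addrC.
Qed.

Lemma varpi_compression_regular l :
  varpi N (op_on N (op_comp (op_comp (op_proj N A) T) (op_proj N A))) l ->
  compression_regular l.
Proof.
move=> [Uker Uran]; split=> [a n Aa Nn Tn|m Nm].
  suff : op_ker (op_sub (op_scale l (op_id N))
      (op_on N (op_comp (op_comp (op_proj N A) T) (op_proj N A)))) n.
    by rewrite Uker.
  apply/op_scale_id_subP; split=> //; exists (l *: n); last by rewrite subrr.
  by apply/op_compressionP; split=> //; [exact: submod_scale | exists a].
move: Nm; rewrite -{1}Uran => -[n /op_scale_id_subP[Nn [s /op_compressionP]]].
move=> [_ _ [a Aa Tn] ->]; exists a, n; split=> //.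
by rewrite opprB [l *: n + _]addrC subrK.
Qed.

(** With respect to [X = A + N], the operator [l - Q T] is block triangular
with the invertible scalar [l] on [A] and the compression on [N]. *)
Lemma compression_regular_FRdom z : A `<=` op_dom T -> z != 0 ->
  compression_regular z^-1 -> FRdom X P T z.
Proof.
move=> Adom z0 [inj surj]; have [TX /submodP[T0 _] _] := Tlin.
have /submodP[A0 _] := Asub; have /submodP[N0 _] := Nsub.
split=> //; rewrite op_proj_compl; split; apply/seteqP; split.
- move=> x /op_scale_id_subP[_ [s [y /= Txy [/= Ns [a Aa yE]]]]] /esym/eqP.
  rewrite subr_eq0 => /eqP sE.
  apply: (inj a) => //; last by rewrite sE addrC -yE.
  have -> : x = z *: s by rewrite -sE scalerA mulfV// scale1r.
  exact: submod_scale.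
- move=> _ ->; apply/op_scale_id_subP; split.
    by exists 0 => //; exists 0 => //; rewrite addr0.
  exists 0; last by rewrite scaler0 subrr.
  by exists 0 => //; split=> //=; exists 0 => //; rewrite addr0.
- move=> u [x /op_scale_id_subP[Xx [s [y _ [/= Ns _]] ->]]].
  have Xsub := submod_sumset Asub Nsub.
  apply: submod_sub => //; first exact: submod_scale.
  by exists 0 => //; exists s => //; rewrite add0r.
- move=> _ [a Aa [m Nm <-]].
  (* To reach [a + m], the [A]-component of the solution must be [z *: a]; the
     part [q] of its image in [N] is then absorbed in the equation for [n]. *)
  have Aza : A (z *: a) by exact: submod_scale.
  have [y Ty] := Adom _ Aza.
  have [_ [p Ap [q Nq pq]]] := TX _ Ty; rewrite /= in pq; subst y.
  have [b [n [Ab Nn Tn]]] := surj _ (submod_add Nsub Nm Nq).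
  have Nln : N (z^-1 *: n) by exact: submod_scale.
  exists (z *: a + n); apply/op_scale_id_subP; split.
    by exists (z *: a) => //; exists n.
  exists (z^-1 *: n - m).
    exists (p + q + (b + (z^-1 *: n - (m + q)))); first exact: graph_add Tlin Ty Tn.
    split=> /=; first exact: submod_sub.
    exists (p + b); first exact: submod_add.
    by rewrite addrACA opprD [q + (_ + _)]addrCA [q + _]addrC subrK addrC.
  rewrite scalerDr scalerA mulVf// scale1r opprB -addrA.
  by rewrite [_ + (m - _)]addrC subrK.
Qed.

End FirstReturn.

(** * Gluing two operators along a common summand *)

Section Gluing.
Set Implicit Arguments.
Unset Strict Implicit.
Context {K : numFieldType} {V : normedModType K}.
Variables (Bm B0 Bp : set V) (TL TR : set (V * V)).
Hypothesis msub : GRing.submod_closed (mem Bm).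
Hypothesis zsub : GRing.submod_closed (mem B0).
Hypothesis psub : GRing.submod_closed (mem Bp).
Hypothesis ds : direct_sum3 Bm B0 Bp.
Local Notation BL := (sumset Bm B0).
Local Notation BR := (sumset B0 Bp).
Hypothesis TLlin : is_linop BL TL.
Hypothesis TRlin : is_linop BR TR.
Hypothesis TLdom : B0 `<=` op_dom TL.
Hypothesis TRdom : B0 `<=` op_dom TR.

Lemma direct_sum3_inj a b c a' b' c' :
  Bm a -> B0 b -> Bp c -> Bm a' -> B0 b' -> Bp c' ->
  a + b + c = a' + b' + c' -> [/\ a = a', b = b' & c = c'].
Proof.
move=> Ba Bb Bc Ba' Bb' Bc' E.
have [t [_ tuniq]] := ds (a + b + c).
have e : t = (a, b, c) by exact: tuniq.
have : t = (a', b', c') by exact: tuniq.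
by rewrite e => -[-> -> ->].
Qed.

Lemma direct_sum3_ex x :
  exists a b c, [/\ Bm a, B0 b, Bp c & x = a + b + c].
Proof. by have [[[a b] c] [[/= ? ? ? ?] _]] := ds x; exists a, b, c. Qed.

Let m0 : Bm 0. Proof. by case/submodP: msub. Qed.
Let z0 : B0 0. Proof. by case/submodP: zsub. Qed.
Let p0 : Bp 0. Proof. by case/submodP: psub. Qed.

Lemma sumset3T : sumset B0 (sumset Bm Bp) = setT.
Proof.
apply/seteqP; split=> // x _; have [a [b [c [? ? ? ->]]]] := direct_sum3_ex x.
by exists b => //; exists (a + c); [exists a => //; exists c | rewrite addrCA addrA].
Qed.

Lemma sumsetLT : sumset BL Bp = setT.
Proof.
apply/seteqP; split=> // x _; have [a [b [c [? ? ? ->]]]] := direct_sum3_ex x.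
by exists (a + b); [exists a => //; exists b | exists c].
Qed.

Lemma sumsetRT : sumset Bm BR = setT.
Proof.
apply/seteqP; split=> // x _; have [a [b [c [? ? ? ->]]]] := direct_sum3_ex x.
by exists a => //; exists (b + c); [exists b => //; exists c | rewrite addrA].
Qed.

Lemma disjoint_Lp : BL `&` Bp = [set 0].
Proof.
apply/seteqP; split=> [x [[a Ba [b Bb abx]] Bx]|_ ->].
  have [] := direct_sum3_inj Ba Bb p0 m0 z0 Bx _.
    by rewrite addr0 abx !add0r.
  by move=> _ _ <-.
by split=> //; exists 0 => //; exists 0 => //; rewrite addr0.
Qed.

Lemma disjoint_mR : Bm `&` BR = [set 0].
Proof.
apply/seteqP; split=> [x [Bx [b Bb [c Bc bcx]]]|_ ->].
  have [] := direct_sum3_inj m0 Bb Bc Bx z0 p0 _.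
    by rewrite !addr0 add0r.
  by move=> <-.
by split=> //; exists 0 => //; exists 0 => //; rewrite addr0.
Qed.

Lemma disjoint_0m : B0 `&` Bm = [set 0].
Proof.
apply/seteqP; split=> [x [Bx Bx']|_ ->] //.
rewrite -disjoint_mR; split=> //; exists x => //.
by exists 0 => //; rewrite addr0.
Qed.

Lemma disjoint_0p : B0 `&` Bp = [set 0].
Proof.
apply/seteqP; split=> [x [Bx Bx']|_ ->] //.
rewrite -disjoint_Lp; split=> //; exists 0 => //.
by exists x => //; rewrite add0r.
Qed.

Lemma disjoint_0mp : B0 `&` sumset Bm Bp = [set 0].
Proof.
apply/seteqP; split=> [x [Bx [a Ba [c Bc acx]]]|_ ->].
  have [] := direct_sum3_inj Ba z0 Bc m0 Bx p0 _.
    by rewrite !addr0 add0r.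
  by move=> _ <-.
by split=> //; exists 0 => //; exists 0 => //; rewrite addr0.
Qed.

Let TLlin' : is_linop (sumset B0 Bm) TL. Proof. by rewrite sumsetC. Qed.
Let Lsub : GRing.submod_closed (mem BL). Proof. exact: submod_sumset. Qed.
Let Rsub : GRing.submod_closed (mem BR). Proof. exact: submod_sumset. Qed.
Let mpsub : GRing.submod_closed (mem (sumset Bm Bp)).
Proof. exact: submod_sumset. Qed.

Lemma op_dsum_linop_L S : is_linop Bp S -> is_linop setT (op_dsum TL S).
Proof. by move=> Slin; rewrite -sumsetLT; apply: is_linop_dsum => //; exact: disjoint_Lp. Qed.

Lemma op_dsum_linop_R S : is_linop Bm S -> is_linop setT (op_dsum S TR).
Proof. by move=> Slin; rewrite -sumsetRT; apply: is_linop_dsum => //; exact: disjoint_mR. Qed.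

Definition glued_sum := op_add (op_dsum TL (op_zero Bp)) (op_dsum (op_zero Bm) TR).
Definition glued_prod := op_comp (op_dsum TL (op_id Bp)) (op_dsum (op_id Bm) TR).

Lemma op_dsumLE S a b c p : S `<=` Bp `*` Bp -> Bm a -> B0 b -> Bp c ->
  op_dsum TL S (a + b + c, p) <->
  exists a' b' s, [/\ Bm a', B0 b', TL (a + b, a' + b'), S (c, s) & p = a' + b' + s].
Proof.
move=> SBp Ba Bb Bc; have [TLB _ _] := TLlin.
have Bab : BL (a + b) by exists a => //; exists b.
rewrite (op_dsumE _ Lsub psub disjoint_Lp TLB SBp Bab Bc).
split=> [[l [s [Tl Ss ->]]]|[a' [b' [s [Ba' Bb' Tab Ss ->]]]]]; last by exists (a' + b'), s.
have [_ [a' Ba' [b' Bb' lE]]] := TLB _ Tl; rewrite /= in lE; subst l.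
by exists a', b', s.
Qed.

Lemma op_dsumRE S a b c p : S `<=` Bm `*` Bm -> Bm a -> B0 b -> Bp c ->
  op_dsum S TR (a + b + c, p) <->
  exists s b' c', [/\ B0 b', Bp c', TR (b + c, b' + c'), S (a, s) & p = s + b' + c'].
Proof.
move=> SBm Ba Bb Bc; have [TRB _ _] := TRlin.
have Bbc : BR (b + c) by exists b => //; exists c.
rewrite -addrA (op_dsumE _ msub Rsub disjoint_mR SBm TRB Ba Bbc).
split=> [[s [r [Ss Tr ->]]]|[s [b' [c' [Bb' Bc' Tbc Ss ->]]]]].
  have [_ [b' Bb' [c' Bc' rE]]] := TRB _ Tr; rewrite /= in rE; subst r.
  by exists s, b', c'; rewrite addrA.
by exists s, (b' + c'); rewrite addrA.
Qed.

(** The two summands see [a + b] and [b + c]; only their [B0]-components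
interact. *)
Lemma glued_sumE a b c p : Bm a -> B0 b -> Bp c ->
  glued_sum (a + b + c, p) <->
  exists a' b1 b2 c', [/\ Bm a', B0 b1, B0 b2 & Bp c'] /\
    [/\ TL (a + b, a' + b1), TR (b + c, b2 + c') & p = a' + (b1 + b2) + c'].
Proof.
move=> Ba Bb Bc.
have [zmB _ _] := op_zero_linop msub; have [zpB _ _] := op_zero_linop psub.
split.
  move=> [u [v [/(op_dsumLE _ zpB Ba Bb Bc) Lu /(op_dsumRE _ zmB Ba Bb Bc) Rv pE]]].
  have [a' [b1 [s [Ba' Bb1 Tab [_ s0] uE]]]] := Lu.
  have [t [b2 [c' [Bb2 Bc' Tbc [_ t0] vE]]]] := Rv.
  rewrite /= in s0 t0 pE; subst s t u v p.
  by exists a', b1, b2, c'; split=> //; split=> //; rewrite addr0 add0r !addrA.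
move=> [a' [b1 [b2 [c' [[Ba' Bb1 Bb2 Bc'] [Tab Tbc ->]]]]]].
exists (a' + b1 + 0), (0 + b2 + c'); split=> /=.
- by apply/(op_dsumLE _ zpB Ba Bb Bc); exists a', b1, 0.
- by apply/(op_dsumRE _ zmB Ba Bb Bc); exists 0, b2, c'.
- by rewrite addr0 add0r !addrA.
Qed.

(** The right factor turns [a + b + c] into [a + e + c'], so the left one is
applied to [a + e] instead of [a + b]. *)
Lemma glued_prodE a b c p : Bm a -> B0 b -> Bp c ->
  glued_prod (a + b + c, p) <->
  exists e a' b' c', [/\ B0 e, Bm a', B0 b' & Bp c'] /\
    [/\ TR (b + c, e + c'), TL (a + e, a' + b') & p = a' + b' + c'].
Proof.
move=> Ba Bb Bc.
have [imB _ _] := op_id_linop msub; have [ipB _ _] := op_id_linop psub.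
split.
  move=> [u /(op_dsumRE _ imB Ba Bb Bc) Ru Lu].
  have [s [e [c' [Be Bc' Tbc [_ sE] uE]]]] := Ru.
  rewrite /= in sE uE Lu; subst s u.
  move/(op_dsumLE _ ipB Ba Be Bc'): Lu => -[a' [b' [t [Ba' Bb' Tae [_ tE] ->]]]].
  by rewrite /= in tE; subst t; exists e, a', b', c'.
move=> [e [a' [b' [c' [[Be Ba' Bb' Bc'] [Tbc Tae ->]]]]]].
exists (a + e + c'); first by apply/(op_dsumRE _ imB Ba Bb Bc); exists a, e, c'.
by apply/(op_dsumLE _ ipB Ba Be Bc'); exists a', b', c'.
Qed.

Lemma glued_sum_linop : is_linop setT glued_sum.
Proof.
apply: is_linop_add; first by rewrite -sumsetLT; exact: submod_sumset.
  by apply: op_dsum_linop_L; exact: op_zero_linop.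
by apply: op_dsum_linop_R; exact: op_zero_linop.
Qed.

Lemma glued_prod_linop : is_linop setT glued_prod.
Proof.
apply: is_linop_comp; first by apply: op_dsum_linop_L; exact: op_id_linop.
by apply: op_dsum_linop_R; exact: op_id_linop.
Qed.

Lemma op_domL_D0 a b : B0 b -> op_dom TL (a + b) <-> op_dom TL a.
Proof.
move=> /TLdom Tb; split=> Ta; last exact: (dom_add TLlin Ta Tb).
by rewrite -[a](addrK b); exact: (dom_sub TLlin Ta Tb).
Qed.

Lemma op_domR_D0 b c : B0 b -> op_dom TR (b + c) <-> op_dom TR c.
Proof.
move=> /TRdom Tb; split=> Tc; last exact: (dom_add TRlin Tb Tc).
by rewrite -[c](addrK b) [c + b]addrC; exact: (dom_sub TRlin Tc Tb).
Qed.

(** Since [B0] lies in both domains, membership in either domain does not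
depend on the [B0]-component. *)
Lemma sumset_domE a b c : Bm a -> B0 b -> Bp c ->
  sumset (op_dom TL) (op_dom TR) (a + b + c) <-> op_dom TL a /\ op_dom TR c.
Proof.
move=> Ba Bb Bc; have [TLB _ _] := TLlin; have [TRB _ _] := TRlin.
split=> [[s Ts [t Tt stE]]|[Ta Tc]]; last first.
  by exists (a + b); [exact/op_domL_D0 | exists c].
have [s' /TLB[/= [a1 Ba1 [b1 Bb1 sE]] _]] := Ts.
have [t' /TRB[/= [b2 Bb2 [c1 Bc1 tE]] _]] := Tt.
subst s t; have Bb12 := submod_add zsub Bb1 Bb2.
have [|-> _ ->] := direct_sum3_inj Ba Bb Bc Ba1 Bb12 Bc1.
  by rewrite -stE !addrA.
by split; [apply/(op_domL_D0 _ Bb1) | apply/(op_domR_D0 _ Bb2)].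
Qed.

Lemma op_domL_comp a : op_dom TL a -> exists a' b', [/\ Bm a', B0 b' & TL (a, a' + b')].
Proof.
have [TLB _ _] := TLlin.
move=> [l Tl]; have [_ [a' Ba' [b' Bb' lE]]] := TLB _ Tl.
by exists a', b'; rewrite lE.
Qed.

Lemma op_domR_comp c : op_dom TR c -> exists b' c', [/\ B0 b', Bp c' & TR (c, b' + c')].
Proof.
have [TRB _ _] := TRlin.
move=> [r Tr]; have [_ [b' Bb' [c' Bc' rE]]] := TRB _ Tr.
by exists b', c'; rewrite rE.
Qed.

Lemma op_dom_glued_sum : op_dom glued_sum = sumset (op_dom TL) (op_dom TR).
Proof.
apply/seteqP; split=> x; have [a [b [c [Ba Bb Bc ->]]]] := direct_sum3_ex x.
  move=> [p /(glued_sumE _ Ba Bb Bc)[a' [b1 [b2 [c' [_ [Tab Tbc _]]]]]]].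
  apply/sumset_domE => //; split; first by apply/(op_domL_D0 _ Bb); exists (a' + b1).
  by apply/(op_domR_D0 _ Bb); exists (b2 + c').
move=> /(sumset_domE Ba Bb Bc)[/(op_domL_D0 _ Bb) + /(op_domR_D0 _ Bb)].
move=> /op_domL_comp[a' [b1 [? ? ?]]] /op_domR_comp[b2 [c' [? ? ?]]].
by exists (a' + (b1 + b2) + c'); apply/glued_sumE => //; exists a', b1, b2, c'.
Qed.

Lemma op_dom_glued_prod : op_dom glued_prod = sumset (op_dom TL) (op_dom TR).
Proof.
apply/seteqP; split=> x; have [a [b [c [Ba Bb Bc ->]]]] := direct_sum3_ex x.
  move=> [p /(glued_prodE _ Ba Bb Bc)[e [a' [b' [c' [[Be _ _ _] [Tbc Tae _]]]]]]].
  apply/sumset_domE => //; split; first by apply/(op_domL_D0 _ Be); exists (a' + b').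
  by apply/(op_domR_D0 _ Bb); exists (e + c').
move=> /(sumset_domE Ba Bb Bc)[Ta /(op_domR_D0 _ Bb)].
move=> /op_domR_comp[e [c' [Be ? ?]]].
move: Ta => /(op_domL_D0 _ Be)/op_domL_comp[a' [b' [? ? ?]]].
by exists (a' + b' + c'); apply/glued_prodE => //; exists e, a', b', c'.
Qed.

Let add_mid (x y w : V) : w + (x + y) = x + w + y.
Proof. by rewrite addrCA addrA. Qed.

(** The compression of the sum to [Bm + Bp] is the direct sum of the two
compressions. *)
Lemma glued_sum_regular l :
  compression_regular B0 Bm TL l -> compression_regular B0 Bp TR l ->
  compression_regular B0 (sumset Bm Bp) glued_sum l.
Proof.
move=> [injL surjL] [injR surjR]; split=> [b _ Bb [a Ba [c Bc <-]]|_ [a Ba [c Bc <-]]].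
  rewrite scalerDr add_mid -[a]addr0 => /(glued_sumE _ Ba z0 Bc).
  rewrite addr0 add0r => -[a' [b1 [b2 [c' [[Ba' Bb1 Bb2 Bc'] [Tab Tbc E]]]]]].
  have [a'E _ c'E] := direct_sum3_inj (submod_scale l msub Ba) Bb
    (submod_scale l psub Bc) Ba' (submod_add zsub Bb1 Bb2) Bc' E.
  subst a' c'; rewrite addrC in Tab.
  by rewrite (injL _ _ Bb1 Ba Tab) (injR _ _ Bb2 Bc Tbc) addr0.
have [b1 [x [Bb1 Bx Tx]]] := surjL _ Ba.
have [b2 [y [Bb2 By Ty]]] := surjR _ Bc.
exists (b1 + b2), (x + y); split; [exact: submod_add|by exists x => //; exists y|].
rewrite scalerDr opprD [l *: x + _ + _]addrACA add_mid -[x in (x + y, _)]addr0.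
apply/glued_sumE => //; exists (l *: x - a), b1, b2, (l *: y - c).
split; split=> //.
- by apply: submod_sub => //; exact: submod_scale.
- by apply: submod_sub => //; exact: submod_scale.
- by rewrite addr0 addrC.
- by rewrite add0r.
Qed.

(** On [Bm + Bp] the compression of the product is triangular: [TR] acts first
on the [Bp]-component [c] alone, and the resulting [e] in [B0] is fed by [TL]
into the equation for the [Bm]-component. *)
Lemma glued_prod_regular l :
  compression_regular B0 Bm TL l -> compression_regular B0 Bp TR l ->
  compression_regular B0 (sumset Bm Bp) glued_prod l.
Proof.
move=> [injL surjL] [injR surjR]; split=> [b _ Bb [a Ba [c Bc <-]]|_ [a Ba [c Bc <-]]].
  rewrite scalerDr add_mid -[a]addr0 => /(glued_prodE _ Ba z0 Bc).
  rewrite addr0 add0r => -[e [a' [b' [c' [[Be Ba' Bb' Bc'] [Tbc Tae E]]]]]].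
  have [a'E _ c'E] := direct_sum3_inj (submod_scale l msub Ba) Bb
    (submod_scale l psub Bc) Ba' Bb' Bc' E.
  subst a' c'; have c0 := injR _ _ Be Bc Tbc; subst c.
  have [_ _ TRfun] := TRlin; have [_ /submodP[TR0 _] _] := TRlin.
  have e0 : e = 0 by have := TRfun _ _ _ Tbc TR0; rewrite scaler0 addr0.
  subst e; rewrite addr0 addrC in Tae.
  by rewrite (injL _ _ Bb' Ba Tae) addr0.
have [e [y [Be By Ty]]] := surjR _ Bc.
(* [p] is the [Bm]-component of [TL e], to be compensated by adding it to the
   right-hand side of the equation solved on [Bm]. *)
have [p [q [Bp' Bq Te]]] := op_domL_comp (TLdom Be).
have [b [x [Bb Bx Tx]]] := surjL _ (submod_add msub Ba Bp').
exists (b + q), (x + y); split; [exact: submod_add|by exists x => //; exists y|].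
rewrite scalerDr opprD [l *: x + _ + _]addrACA add_mid -[x in (x + y, _)]addr0.
apply/glued_prodE => //; exists e, (l *: x - a), (b + q), (l *: y - c).
split; split=> //.
- by apply: submod_sub => //; exact: submod_scale.
- exact: submod_add.
- by apply: submod_sub => //; exact: submod_scale.
- by rewrite add0r.
have -> : l *: x - a + (b + q) = b + (l *: x - (a + p)) + (p + q).
  rewrite -[RHS]addrA [_ + (p + q)]addrA opprD [l *: x + (_ - _)]addrA subrK.
  exact: addrCA.
exact: (graph_add TLlin).
Qed.

Section Values.
Variables (z : K) (z_neq0 : z != 0).

Let FRL := FR_graph zsub msub disjoint_0m TLlin' z_neq0.
Let FRR := FR_graph zsub psub disjoint_0p TRlin z_neq0.

Let FRT T (Tlin : is_linop setT T) :
  FR setT B0 (op_proj B0 (sumset Bm Bp)) T z = [set p | [/\ B0 p.1, B0 p.2 &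
    exists2 n, sumset Bm Bp n & T (p.1 + n, p.2 + z^-1 *: n)]].
Proof.
move: Tlin; rewrite -sumset3T => Tlin.
exact: (FR_graph zsub mpsub disjoint_0mp Tlin z_neq0).
Qed.

Lemma FR_glued_sum :
  FR setT B0 (op_proj B0 (sumset Bm Bp)) glued_sum z =
  op_add (FR BL B0 (op_proj B0 Bm) TL z) (FR BR B0 (op_proj B0 Bp) TR z).
Proof.
rewrite (FRT glued_sum_linop) [BL]sumsetC FRL FRR.
apply/seteqP; split=> -[w v].
  move=> /= [Bw Bv [_ [a Ba [c Bc <-]]]].
  rewrite scalerDr (add_mid a) (add_mid (_ *: a)) => /(glued_sumE _ Ba Bw Bc).
  move=> [a' [b1 [b2 [c' [[Ba' Bb1 Bb2 Bc'] [Tab Tbc E]]]]]].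
  have [a'E vE c'E] := direct_sum3_inj (submod_scale _ msub Ba) Bv
    (submod_scale _ psub Bc) Ba' (submod_add zsub Bb1 Bb2) Bc' E.
  subst a' v c'; exists b1, b2; split=> //; split=> //=; last by exists c.
  by exists a => //; rewrite addrC [b1 + _]addrC.
move=> [b1 [b2 [/= [/= Bw Bb1 [a Ba Ta]] [/= _ Bb2 [c Bc Tc]] ->]]].
split=> //=; first exact: submod_add.
exists (a + c); first by exists a => //; exists c.
rewrite scalerDr (add_mid a) (add_mid (_ *: a)); apply/glued_sumE => //.
exists (z^-1 *: a), b1, b2, (z^-1 *: c); split; split=> //.
- exact: submod_scale.
- exact: submod_scale.
- by rewrite addrC [_ + b1]addrC.
Qed.

Lemma FR_glued_prod :
  FR setT B0 (op_proj B0 (sumset Bm Bp)) glued_prod z =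
  op_comp (FR BL B0 (op_proj B0 Bm) TL z) (FR BR B0 (op_proj B0 Bp) TR z).
Proof.
rewrite (FRT glued_prod_linop) [BL]sumsetC FRL FRR.
apply/seteqP; split=> -[w v].
  move=> /= [Bw Bv [_ [a Ba [c Bc <-]]]].
  rewrite scalerDr (add_mid a) (add_mid (_ *: a)) => /(glued_prodE _ Ba Bw Bc).
  move=> [e [a' [b' [c' [[Be Ba' Bb' Bc'] [Tbc Tae E]]]]]].
  have [a'E vE c'E] := direct_sum3_inj (submod_scale _ msub Ba) Bv
    (submod_scale _ psub Bc) Ba' Bb' Bc' E.
  subst a' v c'; exists e; split=> //=; first by exists c.
  by exists a => //; rewrite addrC [b' + _]addrC.
move=> [e /= [/= Bw Be [c Bc Tc]] [/= _ Bv [a Ba Ta]]].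
split=> //=; exists (a + c); first by exists a => //; exists c.
rewrite scalerDr (add_mid a) (add_mid (_ *: a)); apply/glued_prodE => //.
exists e, (z^-1 *: a), v, (z^-1 *: c); split; split=> //.
- exact: submod_scale.
- exact: submod_scale.
- by rewrite addrC [_ + v]addrC.
Qed.

End Values.

(** [B0] lies in the domain of either glued operator, being contained in both
[op_dom TL] and [op_dom TR]. *)
Lemma FRdom_glued T (z : K) : z != 0 -> is_linop setT T ->
  op_dom T = sumset (op_dom TL) (op_dom TR) ->
  compression_regular B0 (sumset Bm Bp) T z^-1 ->
  FRdom setT (op_proj B0 (sumset Bm Bp)) T z.
Proof.
rewrite -sumset3T => z_neq0 Tlin domT reg.
apply: compression_regular_FRdom => //.
move=> b Bb; rewrite domT; exists b; first exact: TLdom.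
by exists 0; [exact: TRdom | rewrite addr0].
Qed.

End Gluing.

Theorem theorem6p1 (R : realType) (V : completeNormedModType R[i])
    (Bm B0 Bp : set V) (TL TR : set (V * V)) :
  closed_subspace Bm -> closed_subspace B0 -> closed_subspace Bp ->
  direct_sum3 Bm B0 Bp ->
  let BL := sumset Bm B0 in
  let BR := sumset B0 Bp in
  is_linop BL TL -> is_closed_op BL TL ->
  is_linop BR TR -> is_closed_op BR TR ->
  let P := op_proj B0 (sumset Bm Bp) in
  let PL := op_proj B0 Bm in
  let QL := (op_id BL - PL)%op in
  let PR := op_proj B0 Bp in
  let QR := (op_id BR - PR)%op in
  B0 `<=` op_dom TL -> B0 `<=` op_dom TR ->
  let fL := FR BL B0 PL TL in
  let fR := FR BR B0 PR TR in
  let Z := [set z : R[i] | z != 0 /\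
              (varpi Bm (op_on Bm (QL * TL * QL)%op) `&`
               varpi Bp (op_on Bp (QR * TR * QR)%op)) z^-1] in
  (let T := ((TL (+) op_zero Bp) + (op_zero Bm (+) TR))%op in
   let f := FR setT B0 P T in
   op_dom T = sumset (op_dom TL) (op_dom TR) /\
   forall z, Z z ->
     [/\ FRdom BL PL TL z, FRdom BR PR TR z, FRdom setT P T z
       & f z = (fL z + fR z)%op]) /\
  (let T := ((TL (+) op_id Bp) * (op_id Bm (+) TR))%op in
   let f := FR setT B0 P T in
   op_dom T = sumset (op_dom TL) (op_dom TR) /\
   forall z, Z z ->
     [/\ FRdom BL PL TL z, FRdom BR PR TR z, FRdom setT P T z
       & f z = (fL z * fR z)%op]).
Proof.
move=> [msub _] [zsub _] [psub _] ds BL BR TLlin _ TRlin _ P PL QL PR QR.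
move=> TLdom TRdom fL fR Z.
have zmL := disjoint_0m msub zsub psub ds.
have zpR := disjoint_0p msub zsub psub ds.
(* The first return lemmas take the range of the projection as first summand. *)
have BLE : BL = sumset B0 Bm by exact: sumsetC.
have TLlin' : is_linop (sumset B0 Bm) TL by rewrite -BLE.
have regular z : Z z -> [/\ z != 0, compression_regular B0 Bm TL z^-1
    & compression_regular B0 Bp TR z^-1].
  rewrite /Z /QL /QR BLE !op_proj_compl// => -[z0 [zL zR]].
  by split=> //; exact: varpi_compression_regular.
have domL z : Z z -> FRdom BL PL TL z.
  by move=> /regular[z0 zL _]; rewrite BLE; exact: compression_regular_FRdom.
have domR z : Z z -> FRdom BR PR TR z.
  by move=> /regular[z0 _ zR]; exact: compression_regular_FRdom.
split=> T f; split.
- exact: (op_dom_glued_sum msub zsub psub ds TLlin TRlin).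
- move=> z Zz; have [z0 zL zR] := regular z Zz.
  split; [exact: domL | exact: domR | |].
    apply: (FRdom_glued msub zsub psub ds TLdom TRdom z0).
    + exact: (glued_sum_linop msub zsub psub ds TLlin TRlin).
    + exact: (op_dom_glued_sum msub zsub psub ds TLlin TRlin).
    + exact: (glued_sum_regular msub zsub psub ds TLlin TRlin).
  exact: (FR_glued_sum msub zsub psub ds TLlin TRlin).
- exact: (op_dom_glued_prod msub zsub psub ds TLlin TRlin).
- move=> z Zz; have [z0 zL zR] := regular z Zz.
  split; [exact: domL | exact: domR | |].
    apply: (FRdom_glued msub zsub psub ds TLdom TRdom z0).
    + exact: (glued_prod_linop msub zsub psub ds TLlin TRlin).
    + exact: (op_dom_glued_prod msub zsub psub ds TLlin TRlin).
    + exact: (glued_prod_regular msub zsub psub ds TLlin TRlin).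
  exact: (FR_glued_prod msub zsub psub ds TLlin TRlin).
Qed.
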